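(* Let $\mu$ be an infinitely and compactly supported positive Borel measure on $\mathbb{C}$, and let $\lambda_n$ and $\beta_n$ be the smallest and largest eigenvalues of the $n$-th finite section of the moment matrix $\mathbf{M}(\mu)$. In each of the following two cases: (1) $\lim_{n\to\infty}\beta_n<\infty$ and the Sobolev inner product on $\mathbb{P}[z]$ is the one with $$\langle p,p\rangle_{\mathbf{S}}=\int|p(z)|^2\,d\mathbf{m}+\int|p'(z)|^2\,d\mu;$$ (2) $\lim_{n\to\infty}\lambda_n>0$ and the Sobolev inner product on $\mathbb{P}[z]$ is the one with $$\langle p,p\rangle_{\mathbf{S}}=\int|p(z)|^2\,d\mu+\int|p'(z)|^2\,d\mathbf{m};$$ the set of zeros of the Sobolev orthogonal polynomials (the orthogonal polynomials associated with $\langle\cdot,\cdot\rangle_{\mathbf{S}}$) is bounded.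
   Context: $\mathbb{P}[z]$ is the space of polynomials in $z$ with complex coefficients. $\mathbf{m}$ is the (normalized) Lebesgue measure on the unit circle, so its moment matrix is the identity. Measures have finite moments; the moment matrix of $\mu$ is $\mathbf{M}(\mu)=(c_{n,m})_{n,m=0}^{\infty}$ with $c_{n,m}=\int z^n\overline{z}^m\,d\mu$, and its $n$-th finite section is the truncation to indices $0\le i,j\le n$. Orthonormal polynomials $\varphi_n$ are obtained by Gram–Schmidt from $1,z,z^2,\dots$; the set of zeros is $\{z\in\mathbb{C}:\varphi_n(z)=0\text{ for some }n\}$. *)

(* Defs.v *)
From HB Require Import structures.
From mathcomp Require Import all_boot all_order all_algebra sesquilinear.
From mathcomp Require Import complex.
From mathcomp Require Import all_classical all_reals all_analysis measurable_realfun.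

Set Implicit Arguments.
Unset Strict Implicit.
Unset Printing Implicit Defensive.

Import Order.TTheory GRing.Theory Num.Theory.
Import numFieldNormedType.Exports.

Local Open Scope classical_set_scope.
Local Open Scope complex_scope.
Local Open Scope ring_scope.

(* The topology of the complex plane is the library's one on [R[i]^o], induced
   by the norm of [R[i]]; measures on the plane are taken on its Borel sets. *)
Definition borelC (R : realType) := g_sigma_algebraType (@open R[i]^o).

Section Integral.
Context d (T : measurableType d) (R : realType).
Implicit Types (mu : {measure set T -> \bar R}) (f : T -> R[i]).

Definition Cintegrable mu f : Prop :=
  mu.-integrable setT (EFin \o (fun x => complex.Re (f x))) /\
  mu.-integrable setT (EFin \o (fun x => complex.Im (f x))).

Definition Cintegral mu f : R[i] :=
  Rintegral mu setT (fun x => complex.Re (f x)) +i*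
  Rintegral mu setT (fun x => complex.Im (f x)).

End Integral.

Section Moments.
Context (R : realType).
Implicit Types mu : {measure set (borelC R) -> \bar R}.

Definition monomial (n m : nat) (z : borelC R) : R[i] :=
  (z : R[i]) ^+ n * ((z : R[i])^*)%C ^+ m.

Definition finite_moments mu : Prop :=
  forall n m : nat, Cintegrable mu (monomial n m).

Definition moment mu (n m : nat) : R[i] := Cintegral mu (monomial n m).

Definition moment_section mu (n : nat) : 'M[R[i]]_n.+1 :=
  \matrix_(i, j) moment mu i j.

Definition support mu : set R[i]^o :=
  [set z | forall U : set R[i]^o, open U -> U z -> (0 < mu U)%E].

Definition infinitely_supported mu : Prop := infinite_set (support mu).

Definition compactly_supported mu : Prop := compact (support mu).

End Moments.

Section Eigenvalues.
Context (R : realType) (n : nat).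
Implicit Types (A : 'M[R[i]]_n) (l : R).

(* In the order of [R[i]], [x <= y] forces [y - x] to be real; the bounds below
   thus also say that all the eigenvalues of [A] are real. *)
Definition smallest_eigenvalue A l : Prop :=
  eigenvalue A l%:C /\ forall a : R[i], eigenvalue A a -> l%:C <= a.

Definition largest_eigenvalue A l : Prop :=
  eigenvalue A l%:C /\ forall a : R[i], eigenvalue A a -> a <= l%:C.

End Eigenvalues.

Section Circle.
Context (R : realType).

Definition circle_param (t : measurableTypeR R) : borelC R := cos t +i* sin t.

Lemma continuous_real_complex : continuous (fun x : R => x%:C : R[i]^o).
Proof.
move=> x; apply/cvgrPdist_lt => e e0.
have e0' : 0 < complex.Re e by move: e0; rewrite ltcE/= => /andP[].
near=> y.
have -> : e = (complex.Re e)%:C by rewrite RRe_real// gtr0_real.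
rewrite -rmorphB/= normc_def/= expr0n/= addr0 sqrtr_sqr ltcR.
by near: y; move/cvgrPdist_lt : (@cvg_id _ (nbhs x)); exact.
Unshelve. all: by end_near. Qed.

Lemma continuous_circle_param : continuous (circle_param : R -> R[i]^o).
Proof.
move=> t.
have -> : (circle_param : R -> R[i]^o) =
    (fun t => (cos t)%:C + 'i%C *: ((sin t)%:C : R[i]^o)).
  by apply/funext => u; apply/eqP; rewrite eq_complex/= !mul0r !mul1r subrr
     addr0 !add0r !eqxx.
apply: cvgD; last apply: cvgZl_tmp.
- by apply: continuous_comp; [exact: continuous_cos|exact: continuous_real_complex].
- by apply: continuous_comp; [exact: continuous_sin|exact: continuous_real_complex].
Qed.

Lemma measurable_circle_param : measurable_fun setT circle_param.
Proof.
apply: measurability => // _ [U oU <-]; rewrite setTI.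
apply: open_measurable; apply: open_comp => // t _.
exact: continuous_circle_param.
Qed.

HB.instance Definition _ :=
  isMeasurableFun.Build _ _ _ _ circle_param measurable_circle_param.

Lemma two_pi_gt0 : 0 < pi *+ 2 :> R.
Proof. by rewrite mulrn_wgt0 ?pi_gt0. Qed.

(* Normalized Lebesgue measure on the unit circle, as the law of [exp (i t)] for
   [t] uniform on [[0, 2 pi]]. *)
Definition circle_measure : probability (borelC R) R :=
  distribution (uniform_prob two_pi_gt0) circle_param.

End Circle.

Section Sobolev.
Context (R : realType) (mu0 mu1 : {measure set (borelC R) -> \bar R}).

(* A Hermitian sesquilinear form is determined by its diagonal, so at most one
   inner product satisfies this. *)
Definition is_sobolev_product (S : {dot {poly R[i]} for Num.conj}) : Prop :=
  forall p : {poly R[i]},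
    S p p = Cintegral mu0 (fun z => `|p.[z : R[i]]| ^+ 2) +
            Cintegral mu1 (fun z => `|p^`().[z : R[i]]| ^+ 2).

End Sobolev.

(* [gram_schmidt n] lists the orthonormalization of 1, 'X, ..., 'X^(n-1). *)
Section GramSchmidt.
Context (R : realType) (S : {dot {poly R[i]} for Num.conj}).

Fixpoint gram_schmidt (n : nat) : seq {poly R[i]} :=
  if n is k.+1 then
    let s := gram_schmidt k in
    let psi := 'X^k - \sum_(phi <- s) S 'X^k phi *: phi in
    rcons s ((sqrtC (S psi psi))^-1 *: psi)
  else [::].

Definition orthonormal_poly (n : nat) : {poly R[i]} :=
  last 0 (gram_schmidt n.+1).

Definition orthonormal_zeros : set R[i]^o :=
  [set z | exists n : nat, (orthonormal_poly n).[z : R[i]] = 0].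

End GramSchmidt.

(* Main.v *)
Require Import Defs.
From HB Require Import structures.
From mathcomp Require Import all_boot all_order all_algebra sesquilinear.
From mathcomp Require Import complex.
From mathcomp Require Import all_classical all_reals all_analysis.
From mathcomp Require Import spectral measurable_realfun ring lra.

Set Implicit Arguments.
Unset Strict Implicit.
Unset Printing Implicit Defensive.

Import Order.TTheory GRing.Theory Num.Theory.
Import numFieldNormedType.Exports.

Local Open Scope classical_set_scope.
Local Open Scope complex_scope.
Local Open Scope ring_scope.

(** If [S ('X * q) ('X * q) <= c * S q q] for all [q], then every zero [z] of an
    orthonormal polynomial satisfies [|z|^2 <= c]: writing
    [phi_n = ('X - z) * q], orthogonality of [phi_n] and [q] gives
    [S ('X * q) ('X * q) = S phi_n phi_n + |z|^2 * S q q].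
    So it suffices to bound multiplication by ['X] in the Sobolev norm. From
    [('X * p)' = p + 'X * p'], the only term to control is [p] in the norm of
    the measure integrating the derivative. The circle gives the coefficient
    norm, and the Rayleigh quotients of the moment matrix compare it with the
    norm of [mu]: from above by [lim beta_n], from below by [lim lambda_n].
    Multiplication by ['X] is bounded in the norm of [mu] because [mu] is carried
    by a disc. *)

(** * Gram-Schmidt and zeros *)

Section OrthonormalPolynomials.
Context (R : realType) (S : {dot {poly R[i]} for Num.conj}).
Implicit Types (p q : {poly R[i]}) (n : nat).

Lemma size_gram_schmidt_sum n (a : {poly R[i]} -> R[i]) :
  (forall phi, phi \in gram_schmidt S n -> size phi <= n)%N ->
  (size (\sum_(phi <- gram_schmidt S n) a phi *: phi)%R <= n)%N.
Proof.
move=> sz; rewrite big_seq.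
apply: (leq_trans (size_sum _ _ _)); apply/bigmax_leqP_seq => q qs _.
exact/(leq_trans (size_scale_leq _ _))/sz.
Qed.

Lemma size_gram_schmidt n phi : phi \in gram_schmidt S n -> (size phi <= n)%N.
Proof.
elim: n phi => [//|n IH] phi /=; rewrite mem_rcons inE => /predU1P[->|/IH]; last first.
  exact: leqW.
rewrite (leq_trans (size_scale_leq _ _))// (leq_trans (size_polyD _ _))//.
by rewrite geq_max size_polyXn leqnn size_polyN /= leqW// size_gram_schmidt_sum.
Qed.

(** The component of [p] orthogonal to the first [n] orthonormal polynomials. Taking [p] arbitrary,
    and not only ['X^n], is what lets the orthogonality proof go by induction on [n]. *)
Definition gs_residual n p := p - \sum_(phi <- gram_schmidt S n) S p phi *: phi.

Lemma orthonormal_polyE n : orthonormal_poly S n =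
  (sqrtC (S (gs_residual n 'X^n) (gs_residual n 'X^n)))^-1 *: gs_residual n 'X^n.
Proof. by rewrite /orthonormal_poly /= last_rcons. Qed.

(** The subtracted sum has size at most [n], so the coefficient of ['X^n] stays equal to 1. *)
Lemma gs_residual_neq0 n : gs_residual n 'X^n != 0.
Proof.
apply/eqP => /(congr1 (fun p : {poly R[i]} => p`_n)).
rewrite coefB coefXn eqxx coef0 nth_default ?subr0; last first.
  exact/size_gram_schmidt_sum/size_gram_schmidt.
by move/eqP; rewrite oner_eq0.
Qed.

Lemma size_orthonormal_poly n : (size (orthonormal_poly S n) <= n.+1)%N.
Proof.
apply: size_gram_schmidt; rewrite /orthonormal_poly /=.
by rewrite last_rcons mem_rcons mem_head.
Qed.

Lemma orthonormal_poly_neq0 n : orthonormal_poly S n != 0.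
Proof.
rewrite orthonormal_polyE scaler_eq0 negb_or gs_residual_neq0 andbT.
by rewrite invr_eq0 sqrt_dnorm_eq0 gs_residual_neq0.
Qed.

(** Induction on [n]: split [q] into a multiple of [psi] and a remainder [r] of size at most [n].
    The induction hypothesis handles [r], and passing from [n] to [n.+1] subtracts exactly the
    projection onto the normalized [psi]. *)
Lemma gs_residual_ortho n p q : (size q <= n)%N -> S (gs_residual n p) q = 0.
Proof.
elim: n p q => [|n IH] p q.
  by rewrite size_poly_leq0 => /eqP ->; rewrite linear0r.
move=> sq; set psi := gs_residual n 'X^n.
set a := (sqrtC (S psi psi))^-1.
have phiE : gs_residual n.+1 p = gs_residual n p - S p (a *: psi) *: (a *: psi).
  by rewrite /gs_residual /= -cats1 big_cat /= big_seq1 opprD addrA.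
have [r sr ->] : exists2 r : {poly R[i]}, (size r <= n)%N & q = q`_n *: psi + r.
  exists (q - q`_n *: psi); last by rewrite addrC subrK.
  rewrite /psi /gs_residual scalerBr opprB addrCA.
  rewrite (leq_trans (size_polyD _ _))// geq_max.
  rewrite (leq_trans (size_scale_leq _ _)) /=; last first.
    exact/size_gram_schmidt_sum/size_gram_schmidt.
  apply/leq_sizeP => j; rewrite leq_eqVlt coefB coefZ coefXn.
  case/predU1P => [->|nj]; first by rewrite eqxx mulr1 subrr.
  by rewrite gtn_eqF// mulr0 subr0 nth_default// (leq_trans sq).
have Dr u v w : S u (v + w) = S u v + S u w by rewrite linearDr.
have Bl u v w : S (u - v) w = S u w - S v w by rewrite linearBl.
have Zl b u v : S (b *: u) v = b * S u v by rewrite linearZl_LR.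
have Zr b u v : S u (b *: v) = b^* * S u v by rewrite linearZr_LR.
have C u v : S u v = (S v u)^* by rewrite hermC expr0 mul1r.
have psi0 : S psi psi != 0 by rewrite dnorm_eq0 gs_residual_neq0.
have a0 : 0 <= a by rewrite invr_ge0 sqrt_dnorm_ge0.
have a2 : a * a * S psi psi = 1.
  by rewrite -invfM -expr2 sqrtCK mulVf.
have aC : a^* = a by apply: CrealP; exact: ger0_real.
(* The terms subtracted from [p] have size at most [n], hence are orthogonal to [psi] by the
   induction hypothesis and Hermitian symmetry. *)
have Sp : S (gs_residual n p) psi = S p psi.
  rewrite Bl [X in _ - X]C (_ : S psi _ = 0) ?conjC0 ?subr0// IH//.
  exact/size_gram_schmidt_sum/size_gram_schmidt.
rewrite phiE Dr.
rewrite !(Bl (gs_residual n p)) !Zl (IH _ r)// (IH _ r)// !mulr0 subr0 addr0.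
rewrite !Zr Sp aC.
move: a2; generalize (S psi psi) (S p psi) => x y a2.
by rewrite (_ : _ - _ = (q`_n)^* * y * (1 - a * a * x)); [rewrite a2 subrr mulr0|ring].
Qed.

Lemma orthonormal_zeros_sqr_le (c : R[i]) n z :
  (forall q, S ('X * q) ('X * q) <= c * S q q) ->
  (orthonormal_poly S n).[z] = 0 -> `|z| ^+ 2 <= c.
Proof.
move=> Sc /eqP; rewrite -/(root _ z) => /factor_theorem[q phiE].
have phi0 := orthonormal_poly_neq0 n; have sphi := size_orthonormal_poly n.
have q0 : q != 0 by apply: contraNneq phi0 => q0; rewrite phiE q0 mul0r.
(* Removing the factor ['X - z] lowers the size by one, which puts [q] among the polynomials
   orthogonal to [orthonormal_poly S n]. *)
have sq : (size q <= n)%N.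
  by move: sphi; rewrite phiE size_Mmonic ?monicXsubC// size_XsubC addn2.
have Sphi : S (orthonormal_poly S n) q = 0.
  have h := gs_residual_ortho (n := n) 'X^n sq.
  rewrite orthonormal_polyE linearZl_LR /=. by rewrite h mulr0.
have XqE : 'X * q = orthonormal_poly S n + z *: q.
  by rewrite phiE mulrBr mulrC -mul_polyC [z%:P * _]mulrC subrK.
have := Sc q; rewrite XqE hnormDd; last first.
  transitivity (z^* * S (orthonormal_poly S n) q); last by rewrite Sphi mulr0.
  by rewrite linearZr_LR.
have Sz : S (z *: q) (z *: q) = `|z| ^+ 2 * S q q by exact: dnormZ.
have Sq : 0 < S q q by rewrite dnorm_gt0.
have S0 : 0 <= S (orthonormal_poly S n) (orthonormal_poly S n) by exact: dnorm_ge0.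
move=> h; rewrite -(ler_pM2r Sq) -Sz; apply: le_trans h.
by rewrite lerDr.
Qed.

End OrthonormalPolynomials.

(** * Rayleigh quotients of Hermitian matrices *)

Section Rayleigh.
Context (C : numClosedFieldType) (n : nat).
Implicit Types (A : 'M[C]_n) (v : 'rV[C]_n).
Local Open Scope sesquilinear_scope.

(** Spectral theorem: [A] is diagonal in a unitary basis, [d] lists its eigenvalues and [w] the
    coordinates of [v] in that basis. Both forms become weighted sums, so eigenvalue bounds transfer
    termwise. *)
Lemma hermitian_form_diagonalization A v : A \is hermsymmx ->
  exists d w : 'rV[C]_n, [/\ forall i, eigenvalue A (d 0 i),
    (v *m A *m v^t*) 0 0 = \sum_i d 0 i * `|w 0 i| ^+ 2 &
    (v *m v^t*) 0 0 = \sum_i `|w 0 i| ^+ 2].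
Proof.
move=> Aherm; have /orthomx_spectralP := hermitian_normalmx Aherm.
set P := spectralmx A; set D := spectral_diag A => AE.
have Pu : P \is unitarymx by exact: spectral_unitarymx.
have PU := unitarymx_unit Pu.
exists D, (v *m P^t*); split.
(* The rows of the unitary matrix [P] are eigenvectors; they are nonzero because they have norm
   1. *)
- move=> i; apply/eigenvalueP; exists (row i P).
    rewrite {1}AE -row_mul -mulmxA mulKVmx// mul_diag_mx.
    by apply/rowP => j; rewrite !mxE.
  apply/eqP => Pi0; have := unitarymxP Pu => /matrixP/(_ i i).
  rewrite !mxE eqxx big1 => [/esym/eqP|j _]; first by rewrite oner_eq0.
  by move/rowP/(_ j): Pi0; rewrite !mxE => ->; rewrite mul0r.
- rewrite AE invmx_unitary// !mulmxA mul_mx_diag -mulmxA.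
  rewrite -[X in _ *m X]trmxCK trmx_mul map_mxM trmxCK.
  rewrite !mxE; apply: eq_bigr => i _; rewrite !mxE normCK.
  by rewrite mulrAC mulrC.
- transitivity ((v *m P^t* *m (v *m P^t*)^t*) 0 0).
    by rewrite trmx_mul map_mxM trmxCK mulmxA mulmxKtV// trmxC_unitary.
  by rewrite mxE; apply: eq_bigr => i _; rewrite !mxE normCK.
Qed.

Lemma hermitian_form_le A v (b : C) : A \is hermsymmx ->
  (forall a, eigenvalue A a -> a <= b) ->
  (v *m A *m v^t*) 0 0 <= b * (v *m v^t*) 0 0.
Proof.
move=> Aherm leb; have [d [w [ed -> ->]]] := hermitian_form_diagonalization v Aherm.
by rewrite mulr_sumr ler_sum// => i _; rewrite ler_wpM2r ?exprn_ge0 ?leb.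
Qed.

Lemma hermitian_form_ge A v (b : C) : A \is hermsymmx ->
  (forall a, eigenvalue A a -> b <= a) ->
  b * (v *m v^t*) 0 0 <= (v *m A *m v^t*) 0 0.
Proof.
move=> Aherm leb; have [d [w [ed -> ->]]] := hermitian_form_diagonalization v Aherm.
by rewrite mulr_sumr ler_sum// => i _; rewrite ler_wpM2r ?exprn_ge0 ?leb.
Qed.

End Rayleigh.

(** * Integrals of complex-valued functions *)

Section ComplexIntegral.
Context d (T : measurableType d) (R : realType).
Context (nu : {measure set T -> \bar R}).
Implicit Types (f g : T -> R[i]).

Lemma CintegrableD f g : Cintegrable nu f -> Cintegrable nu g ->
  Cintegrable nu (fun x => f x + g x).
Proof.
move=> [f1 f2] [g1 g2]; split.
  by apply: eq_integrable (integrableD _ f1 g1) => // x _ /=; rewrite raddfD.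
by apply: eq_integrable (integrableD _ f2 g2) => // x _ /=; rewrite raddfD.
Qed.

Lemma CintegralD f g : Cintegrable nu f -> Cintegrable nu g ->
  Cintegral nu (fun x => f x + g x) = Cintegral nu f + Cintegral nu g.
Proof.
move=> [f1 f2] [g1 g2]; apply/eqP; rewrite eq_complex /=.
rewrite -!RintegralD//; apply/andP; split; apply/eqP;
 by apply: eq_Rintegral => x _; rewrite raddfD.
Qed.

Lemma CintegrableZ (a : R[i]) f : Cintegrable nu f ->
  Cintegrable nu (fun x => a * f x).
Proof.
case: a => a b [f1 f2]; split.
  apply: eq_integrable (integrableB _ (integrableZl _ a f1) (integrableZl _ b f2)) => // x _ /=.
  by case: (f x).
apply: eq_integrable (integrableD _ (integrableZl _ a f2) (integrableZl _ b f1)) => // x _ /=.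
by case: (f x).
Qed.

Lemma CintegralZ (a : R[i]) f : Cintegrable nu f ->
  Cintegral nu (fun x => a * f x) = a * Cintegral nu f.
Proof.
case: a => a b [f1 f2]; apply/eqP; rewrite eq_complex /=.
have Z (c : R) (h : T -> R) : nu.-integrable setT (EFin \o h) ->
    nu.-integrable setT (EFin \o (fun x => c * h x)).
  by move=> ih; apply: eq_integrable (integrableZl _ c ih).
rewrite -!RintegralZl// -RintegralB//; [|exact: Z..].
rewrite -RintegralD//; [|exact: Z..].
by apply/andP; split; apply/eqP; apply: eq_Rintegral => x _; case: (f x).
Qed.

Lemma Cintegrable_sum (I : Type) (s : seq I) (h : I -> T -> R[i]) :
  (forall i, Cintegrable nu (h i)) -> Cintegrable nu (fun x => \sum_(i <- s) h i x).
Proof.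
move=> ih; elim: s => [|i s IH].
  rewrite (_ : (fun _ => _) = cst 0); last by apply/funext => x; rewrite big_nil.
  by split; exact: integrable0.
under eq_fun do rewrite big_cons.
exact: CintegrableD.
Qed.

Lemma Cintegral_sum (I : Type) (s : seq I) (h : I -> T -> R[i]) :
  (forall i, Cintegrable nu (h i)) ->
  Cintegral nu (fun x => \sum_(i <- s) h i x) = \sum_(i <- s) Cintegral nu (h i).
Proof.
move=> ih; elim: s => [|i s IH].
  rewrite (_ : (fun _ => _) = cst 0); last by apply/funext => x; rewrite big_nil.
  by rewrite big_nil /Cintegral /Rintegral /= !integral0.
under eq_fun do rewrite big_cons.
by rewrite big_cons CintegralD// ?IH//; exact: Cintegrable_sum.
Qed.

Lemma Cintegral_ge0 f : (forall x, 0 <= f x) -> 0 <= Cintegral nu f.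
Proof.
move=> f0; rewrite lecE /=; apply/andP; split.
  by rewrite /Rintegral integral0_eq// => x _; rewrite ger0_Im.
by apply: Rintegral_ge0 => x _; have := f0 x; rewrite lecE => /andP[].
Qed.

(** The order of [R[i]] compares real parts and requires equal imaginary parts. Nonnegative values
    are real, so both imaginary parts integrate to 0 and only monotonicity of the real integral
    remains. *)
Lemma ae_ge0_le_Cintegral f g : Cintegrable nu f -> Cintegrable nu g ->
  (forall x, 0 <= f x) -> (forall x, 0 <= g x) ->
  {ae nu, forall x, f x <= g x} -> Cintegral nu f <= Cintegral nu g.
Proof.
move=> [f1 f2] [g1 g2] f0 g0 fg.
have im0 h : (forall x, 0 <= h x) -> Rintegral nu setT (fun x => complex.Im (h x)) = 0.
  move=> h0; rewrite /Rintegral (_ : (fun _ => _) = cst 0%E) ?integral0//.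
  by apply/funext => x; rewrite ger0_Im.
have re0 h x : (forall x, 0 <= h x) -> 0 <= complex.Re (h x).
  by move=> /(_ x); rewrite lecE => /andP[].
rewrite lecE /= !im0// eqxx /=; apply: fine_le.
- exact: integrable_fin_num f1.
- exact: integrable_fin_num g1.
- apply: ae_ge0_le_integral => //.
  + by move=> x _; rewrite lee_fin re0.
  + by case/integrableP: f1.
  + by move=> x _; rewrite lee_fin re0.
  + by case/integrableP: g1.
  + by apply: filterS fg => x; rewrite lecE => /andP[].
Qed.

Lemma Cintegral_conjC f : Cintegrable nu f ->
  Cintegral nu (fun x => (f x)^*%C) = (Cintegral nu f)^*%C.
Proof.
move=> [f1 f2]; apply/eqP; rewrite eq_complex /= -mulN1r -RintegralZl//.
by apply/andP; split; apply/eqP; apply: eq_Rintegral => x _; case: (f x) => //= a b; rewrite mulN1r.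
Qed.

End ComplexIntegral.

(** * Squared norms of polynomials with respect to a measure *)

Section QuadraticForm.
Context (R : realType).
Implicit Types (nu : {measure set (borelC R) -> \bar R}) (p q : {poly R[i]}).

Definition normsq_int nu p : R[i] :=
  Cintegral nu (fun z : borelC R => `|p.[z : R[i]]| ^+ 2).

Lemma normsq_horner_monomials p n (z : borelC R) : (size p <= n)%N ->
  `|p.[z : R[i]]| ^+ 2 =
  \sum_(i < n) \sum_(j < n) p`_i * (p`_j)^*%C * monomial i j z.
Proof.
move=> pn; rewrite sqr_normc (horner_coef_wide _ pn) rmorph_sum mulr_suml.
apply: eq_bigr => i _; rewrite mulr_sumr; apply: eq_bigr => j _.
by rewrite /monomial rmorphM rmorphXn /= mulrACA.
Qed.

Lemma Cintegrable_normsq nu p : finite_moments nu ->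
  Cintegrable nu (fun z : borelC R => `|p.[z : R[i]]| ^+ 2).
Proof.
move=> mom; under eq_fun do rewrite (normsq_horner_monomials _ (leqnn (size p))).
by apply: Cintegrable_sum => i; apply: Cintegrable_sum => j; exact: CintegrableZ.
Qed.

Lemma normsq_int_moments nu p n : finite_moments nu -> (size p <= n)%N ->
  normsq_int nu p = \sum_(i < n) \sum_(j < n) p`_i * (p`_j)^*%C * moment nu i j.
Proof.
move=> mom pn; rewrite /normsq_int.
under eq_fun do rewrite (normsq_horner_monomials _ pn).
rewrite Cintegral_sum => [|i]; last first.
  by apply: Cintegrable_sum => j; exact: CintegrableZ.
apply: eq_bigr => i _; rewrite Cintegral_sum => [|j]; last exact: CintegrableZ.
by apply: eq_bigr => j _; rewrite CintegralZ.
Qed.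

Lemma normsq_int_ge0 nu p : 0 <= normsq_int nu p.
Proof.
by apply: Cintegral_ge0 => z; rewrite exprn_ge0.
Qed.

(** Pointwise parallelogram identity: the right-hand side exceeds the left by [|a - b|^2]. *)
Lemma normsq_intD_le nu p q : finite_moments nu ->
  normsq_int nu (p + q) <= 2 * normsq_int nu p + 2 * normsq_int nu q.
Proof.
move=> mom; have ip := Cintegrable_normsq p mom; have iq := Cintegrable_normsq q mom.
rewrite /normsq_int -!CintegralZ// -CintegralD; [|exact: CintegrableZ..].
apply: ae_ge0_le_Cintegral.
- exact: Cintegrable_normsq.
- by apply: CintegrableD; exact: CintegrableZ.
- by move=> x; rewrite exprn_ge0.
- by move=> x; rewrite addr_ge0 ?mulr_ge0 ?exprn_ge0.
apply: aeW => x; rewrite hornerD; set a := p.[_]; set b := q.[_].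
have : 0 <= `|a - b| ^+ 2 by rewrite exprn_ge0.
move=> h; rewrite -subr_ge0; apply: le_trans h _.
rewrite le_eqVlt; apply/orP; left; apply/eqP.
rewrite !normCK !(rmorphB, rmorphD) /=; ring.
Qed.

Lemma normsq_intMX_le nu (r : R) p : finite_moments nu -> 0 <= r ->
  {ae nu, forall z : borelC R, `|z : R[i]| <= r%:C} ->
  normsq_int nu ('X * p) <= (r ^+ 2)%:C * normsq_int nu p.
Proof.
move=> mom r0 aer; rewrite /normsq_int -CintegralZ; last exact: Cintegrable_normsq.
have r20 : 0 <= (r ^+ 2)%:C by rewrite ler0c exprn_ge0.
apply: ae_ge0_le_Cintegral.
- exact: Cintegrable_normsq.
- exact/CintegrableZ/Cintegrable_normsq.
- by move=> x; rewrite exprn_ge0.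
- by move=> x; rewrite mulr_ge0 ?exprn_ge0.
apply: filterS aer => z zr; rewrite hornerM hornerX normrM exprMn rmorphXn.
by rewrite ler_wpM2r ?exprn_ge0// lerXn2r// nnegrE ?ler0c.
Qed.

Lemma moment_conj nu i j : finite_moments nu -> (moment nu i j)^*%C = moment nu j i.
Proof.
move=> mom; rewrite -Cintegral_conjC//; congr Cintegral; apply/funext => z.
by rewrite /monomial rmorphM !rmorphXn /= conjcK mulrC.
Qed.

End QuadraticForm.

(** * Moment matrices *)

Section MomentSection.
Context (R : realType).
Implicit Types (nu : {measure set (borelC R) -> \bar R}) (p q : {poly R[i]}).
Local Open Scope sesquilinear_scope.

(** The squared l2 norm of the coefficients, which is also the squared norm for the circle measure
    ([normsq_int_circle]). *)
Definition normsq_coef p : R[i] := \sum_(i < size p) `|p`_i| ^+ 2.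

Lemma normsq_coef_wide p n : (size p <= n)%N ->
  normsq_coef p = \sum_(i < n) `|p`_i| ^+ 2.
Proof.
move=> pn; rewrite /normsq_coef (big_ord_widen n (fun i => `|p`_i| ^+ 2) pn).
rewrite big_mkcond; apply: eq_bigr => i _; case: ltnP => // ip.
by rewrite nth_default// normr0 expr0n.
Qed.

Lemma normsq_coef_ge0 p : 0 <= normsq_coef p.
Proof. by apply: sumr_ge0 => i _; rewrite exprn_ge0. Qed.

Lemma normsq_coef_gt0 p : p != 0 -> 0 < normsq_coef p.
Proof.
move=> p0; rewrite lt_neqAle normsq_coef_ge0 andbT eq_sym.
rewrite psumr_neq0 => [|i _]; last by rewrite exprn_ge0.
have sp : ((size p).-1 < size p)%N by rewrite prednK// lt0n size_poly_eq0.
apply/hasP; exists (Ordinal sp); first exact: mem_index_enum.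
by rewrite /= exprn_gt0// normr_gt0 -lead_coefE lead_coef_eq0.
Qed.

Lemma normsq_coefMX p : normsq_coef ('X * p) = normsq_coef p.
Proof.
have [->|p0] := eqVneq p 0; first by rewrite mulr0.
rewrite (@normsq_coef_wide _ (size p).+1); last by rewrite mulrC size_mulX.
rewrite big_ord_recl coefXM /= normr0 expr0n add0r.
by apply: eq_bigr => i _; rewrite coefXM.
Qed.

Lemma normsq_coefD_le p q : normsq_coef (p + q) <= 2 * normsq_coef p + 2 * normsq_coef q.
Proof.
pose n := maxn (size p) (size q).
rewrite !(@normsq_coef_wide _ n) ?leq_maxl ?leq_maxr//; last exact: size_polyD.
rewrite !mulr_sumr -big_split /= ler_sum// => i _; rewrite coefD.
set a := p`_i; set b := q`_i.
have h : 0 <= `|a - b| ^+ 2 by rewrite exprn_ge0.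
rewrite -subr_ge0; apply: le_trans h _.
rewrite le_eqVlt; apply/orP; left; apply/eqP.
rewrite !normCK !(rmorphB, rmorphD) /=; ring.
Qed.

Lemma moment_section_hermitian nu n : finite_moments nu ->
  moment_section nu n \is hermsymmx.
Proof.
move=> mom; apply/is_hermitianmxP; rewrite expr0 scale1r.
by apply/matrixP => i j; rewrite !mxE -moment_conj.
Qed.

(** Expanding [|p|^2] into monomials makes the moments the entries of the form; [rVpoly] reads a row
    vector as a coefficient list. *)
Lemma moment_section_form nu n (v : 'rV[R[i]]_n.+1) : finite_moments nu ->
  (v *m moment_section nu n *m v^t*) 0 0 = normsq_int nu (rVpoly v).
Proof.
move=> mom; rewrite (normsq_int_moments mom (size_poly _ _)) mxE exchange_big /=.
apply: eq_bigr => j _; rewrite mxE mulr_suml; apply: eq_bigr => i _.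
by rewrite !mxE !coef_rVpoly_ord mulrAC.
Qed.

Lemma dotmx_rVpoly n (v : 'rV[R[i]]_n) : (v *m v^t*) 0 0 = normsq_coef (rVpoly v).
Proof.
rewrite (normsq_coef_wide (size_poly _ _)) mxE.
by apply: eq_bigr => i _; rewrite !mxE coef_rVpoly_ord normCK.
Qed.

Lemma smallest_eigenvalue_le nu n l p : finite_moments nu ->
  smallest_eigenvalue (moment_section nu n) l -> (size p <= n.+1)%N ->
  l%:C * normsq_coef p <= normsq_int nu p.
Proof.
move=> mom [_ lmin] pn; have pE : rVpoly (poly_rV p : 'rV_n.+1) = p by exact: poly_rV_K.
rewrite -pE -moment_section_form// -dotmx_rVpoly.
exact/hermitian_form_ge/lmin/moment_section_hermitian.
Qed.

Lemma largest_eigenvalue_ge nu n l p : finite_moments nu ->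
  largest_eigenvalue (moment_section nu n) l -> (size p <= n.+1)%N ->
  normsq_int nu p <= l%:C * normsq_coef p.
Proof.
move=> mom [_ lmax] pn; have pE : rVpoly (poly_rV p : 'rV_n.+1) = p by exact: poly_rV_K.
rewrite -pE -moment_section_form// -dotmx_rVpoly.
exact/hermitian_form_le/lmax/moment_section_hermitian.
Qed.

(** An eigenvector, read as a polynomial, attains its eigenvalue as a Rayleigh quotient. Such a
    polynomial can be tested against the next section, which gives the monotonicity of the extreme
    eigenvalues. *)
Lemma moment_section_eigenpoly nu n a : finite_moments nu ->
  eigenvalue (moment_section nu n) a ->
  exists p, [/\ p != 0, (size p <= n.+1)%N & normsq_int nu p = a * normsq_coef p].
Proof.
move=> mom /eigenvalueP[v vE v0]; exists (rVpoly v); split; last 1 first.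
- by rewrite -moment_section_form// -dotmx_rVpoly vE -scalemxAl mxE.
- by apply: contraNneq v0 => v0; rewrite -[v]rVpolyK v0 linear0.
- exact: size_poly.
Qed.

Context (nu : {measure set (borelC R) -> \bar R}) (mom : finite_moments nu).

Lemma smallest_eigenvalue_nonincreasing (lambda : nat -> R) :
  (forall n, smallest_eigenvalue (moment_section nu n) (lambda n)) ->
  nonincreasing_seq lambda.
Proof.
move=> lambdaP; apply/nonincreasing_seqP => n.
have [p [p0 pn pE]] := moment_section_eigenpoly mom (lambdaP n).1.
have := smallest_eigenvalue_le mom (lambdaP n.+1) (leqW pn).
by rewrite pE ler_pM2r ?normsq_coef_gt0// lecR.
Qed.

Lemma largest_eigenvalue_nondecreasing (beta : nat -> R) :
  (forall n, largest_eigenvalue (moment_section nu n) (beta n)) ->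
  nondecreasing_seq beta.
Proof.
move=> betaP; apply/nondecreasing_seqP => n.
have [p [p0 pn pE]] := moment_section_eigenpoly mom (betaP n).1.
have := largest_eigenvalue_ge mom (betaP n.+1) (leqW pn).
by rewrite pE ler_pM2r ?normsq_coef_gt0// lecR.
Qed.

Lemma normsq_int_ge_limn (lambda : nat -> R) :
  (forall n, smallest_eigenvalue (moment_section nu n) (lambda n)) ->
  (0 < limn (fun n => (lambda n)%:E))%E ->
  exists2 l : R, 0 < l & forall p, l%:C * normsq_coef p <= normsq_int nu p.
Proof.
move=> lambdaP; have ni := smallest_eigenvalue_nonincreasing lambdaP.
have niE : nonincreasing_seq (fun n => (lambda n)%:E).
  by move=> m n mn; rewrite lee_fin ni.
(* Monotonicity ensures that the limit exists and is the infimum [L], hence a lower bound of every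
   [lambda n]; it is finite because it lies between 0 and [lambda 0]. *)
have /cvg_lim -> // := ereal_nonincreasing_cvgn niE.
set L := ereal_inf _ => L0.
have Lle n : (L <= (lambda n)%:E)%E by apply: ereal_inf_lbound; exists n.
have Lfin : L \is a fin_num.
  by rewrite fin_numElt (lt_trans _ L0)//= (le_lt_trans (Lle 0%N))// ltry.
exists (fine L); first by rewrite fine_gt0// L0 -ge0_fin_numE// ltW.
(* The section of index [size p] is large enough to contain all the coefficients of [p]. *)
move=> p; apply: le_trans (smallest_eigenvalue_le mom (lambdaP (size p)) (leqnSn _)).
by rewrite ler_wpM2r ?normsq_coef_ge0// lecR -lee_fin fineK.
Qed.

Lemma normsq_int_le_limn (beta : nat -> R) :
  (forall n, largest_eigenvalue (moment_section nu n) (beta n)) ->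
  (limn (fun n => (beta n)%:E) < +oo)%E ->
  exists b : R, forall p, normsq_int nu p <= b%:C * normsq_coef p.
Proof.
move=> betaP; have nd := largest_eigenvalue_nondecreasing betaP.
have ndE : nondecreasing_seq (fun n => (beta n)%:E).
  by move=> m n mn; rewrite lee_fin nd.
(* Here the limit is the supremum, finite because it lies between [beta 0] and infinity. *)
have /cvg_lim -> // := ereal_nondecreasing_cvgn ndE.
set L := ereal_sup _ => Ly.
have Lge n : ((beta n)%:E <= L)%E by apply: ereal_sup_ubound; exists n.
have Lfin : L \is a fin_num.
  by rewrite fin_numElt Ly (lt_le_trans _ (Lge 0%N))// ltNyr.
exists (fine L) => p.
apply: le_trans (largest_eigenvalue_ge mom (betaP (size p)) (leqnSn _)) _.
by rewrite ler_wpM2r ?normsq_coef_ge0// lecR -lee_fin fineK.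
Qed.

End MomentSection.

(** * Support of a measure on the plane *)

Section ComplexPlane.
Context (R : realType).

Lemma Re_norm (z : R[i]) : (complex.Re `|z|)%:C = `|z|.
Proof. by rewrite RRe_real// normr_real. Qed.

Lemma norm_real_complex (x : R) : `|x%:C| = `|x|%:C :> R[i].
Proof. by rewrite normc_def /= expr0n addr0 sqrtr_sqr. Qed.

Lemma continuous_nonexpansive (f : R[i]^o -> R) :
  (forall x y : R[i], `|f x - f y|%:C <= `|x - y|) -> continuous f.
Proof.
move=> fd x; apply/(@cvgrPdist_lt _ _ _ _ (nbhs_filter (x : R[i]^o))) => e e0.
have e0' : 0 < e%:C :> R[i] by rewrite ltcR.
apply/nbhs_ballP; exists e%:C => //= y xy.
by rewrite /= -ltcR; exact: le_lt_trans (fd _ _) xy.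
Qed.

Lemma continuous_Re : continuous (fun z : R[i]^o => complex.Re z).
Proof.
apply: continuous_nonexpansive => x y.
by rewrite (_ : _ - _ = complex.Re (x - y)) ?normc_ge_Re//; case: x y => ? ? [].
Qed.

Lemma continuous_Im : continuous (fun z : R[i]^o => complex.Im z).
Proof.
apply: continuous_nonexpansive => x y.
(* The imaginary part is the real part after multiplication by [-i], which has modulus 1. *)
rewrite (_ : _ - _ = complex.Re (- 'i%C * (x - y))).
  apply: le_trans (normc_ge_Re _) _; rewrite normrM normrN.
  by rewrite complexiE normCi mul1r.
by case: x y => ? ? [] ? ? /=; ring.
Qed.

Lemma continuous_Re_norm : continuous (fun z : R[i]^o => complex.Re `|z|).
Proof.
apply: continuous_nonexpansive => x y.
have -> : `|complex.Re `|x| - complex.Re `|y| |%:C = `| `|x| - `|y| |.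
  by rewrite -[in RHS](Re_norm x) -[in RHS](Re_norm y) -rmorphB norm_real_complex.
exact: ler_dist_dist.
Qed.

Lemma continuous_conj : continuous (fun z : R[i]^o => (z^*)%C : R[i]^o).
Proof.
move=> x; apply/(@cvgrPdist_lt _ _ _ _ (nbhs_filter (x : R[i]^o))) => e e0.
apply/nbhs_ballP; exists e => //= y xy.
by rewrite /= -rmorphB normcJ.
Qed.

Lemma continuous_exprn n (f : R[i]^o -> R[i]^o) : continuous f ->
  continuous (fun z => f z ^+ n : R[i]^o).
Proof.
move=> cf; elim: n => [|n IH] z; have FF := nbhs_filter (z : R[i]^o).
  by rewrite (_ : (fun _ => _) = cst 1); [exact: cvg_cst|apply/funext => u; rewrite expr0].
rewrite (_ : (fun _ => _) = fun z => f z * f z ^+ n); last by apply/funext => u; rewrite exprS.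
apply: cvgM; [exact: cf|exact: IH].
Qed.

Lemma continuous_monomial n m : continuous (@monomial R n m : R[i]^o -> R[i]^o).
Proof.
move=> z; have FF := nbhs_filter (z : R[i]^o); apply: cvgM.
- by apply: continuous_exprn => x; exact: cvg_id.
- apply: continuous_exprn; exact: continuous_conj.
Qed.

Lemma continuous_measurable_borelC (f : borelC R -> R) :
  continuous (f : R[i]^o -> R) -> measurable_fun setT f.
Proof.
move=> /continuousP cf; apply: (measurability _ (RGenOpens.measurableE R)).
move=> _ [_ [a [b ->] <-]]; rewrite setTI; apply: sub_sigma_algebra.
exact/cf/interval_open.
Qed.

End ComplexPlane.

(** * Null complement of the support *)

Section SupportNull.
Context (R : realType) (nu : {measure set (borelC R) -> \bar R}).

Let rball (k : rat * rat * nat) : set R[i]^o :=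
  ball ((ratr k.1.1 : R) +i* ratr k.1.2 : R[i]^o) (k.2.+1%:R^-1 : R[i]).

Let rball_refine (z : R[i]^o) (U : set R[i]^o) : open U -> U z ->
  exists k, rball k z /\ rball k `<=` U.
Proof.
move=> oU Uz.
have /nbhs_ballP[e /= e0 eU] : nbhs z U by apply: open_nbhs_nbhs; split.
have e0' : 0 < complex.Re e by move: e0; rewrite ltcE/= => /andP[].
have eE : e = (complex.Re e)%:C by rewrite RRe_real// gtr0_real.
(* The radius [dl] is at most half of [e]: a disc of radius [dl] whose centre is within [dl] of [z]
   contains [z] and stays within distance [e] of it. *)
pose n := Num.truncn ((complex.Re e)^-1 * 2).
pose dl : R := n.+1%:R^-1.
have dl0 : 0 < dl by rewrite invr_gt0.
have dle : dl + dl <= complex.Re e.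
  have : (complex.Re e)^-1 * 2 < n.+1%:R by exact: truncnS_gt.
  rewrite -ltf_pV2 ?posrE ?mulr_gt0 ?invr_gt0// invfM invrK -/dl.
  lra.
have ap (x : R) : exists q : rat, `|ratr q - x| < dl / 2.
  have /rat_in_itvoo[q] : x - dl / 2 < x + dl / 2 by lra.
  by rewrite in_itv /= => /andP[q1 q2]; exists q; rewrite ltr_distl q1.
have [q1 h1] := ap (complex.Re z); have [q2 h2] := ap (complex.Im z).
have dist : `|((ratr q1 : R) +i* ratr q2) - (z : R[i])| < dl%:C.
  rewrite (_ : _ - _ = (ratr q1 - complex.Re z)%:C + 'i%C * (ratr q2 - complex.Im z)%:C).
    apply: le_lt_trans (ler_normD _ _) _; rewrite normrM.
    rewrite complexiE normCi mul1r !norm_real_complex -rmorphD ltcR; lra.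
  by apply/eqP; rewrite eq_complex; case: (z) => a b /=; apply/andP; split; apply/eqP; ring.
have dlE : (n.+1%:R^-1 : R[i]) = dl%:C by rewrite /dl fmorphV rmorph_nat.
exists (q1, q2, n); split; rewrite /rball /ball /= /ball_ /= dlE //.
move=> y yq; apply: eU; rewrite /ball /= /ball_ /=.
rewrite -(subrK ((ratr q1 : R) +i* ratr q2) z) -addrA.
apply: le_lt_trans (ler_normD _ _) _; rewrite distrC eE.
apply: lt_le_trans (ltrD dist yq) _.
by rewrite -rmorphD lecR.
Qed.

(* Second countability: the complement of the support is a union of null
   discs with rational centers and radii. *)
Lemma support_negligible : nu.-negligible (~` Defs.support nu).
Proof.
(* Discs of positive measure, and integers that code no disc, contribute [set0], so every [F n] is
   null. *)
pose F n : set (borelC R) := if unpickle n is Some k then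
  if nu (rball k) == 0%E then rball k else set0 else set0.
apply: (@negligibleS _ _ _ nu (\bigcup_n F n)) => [z /= zs|].
  have [U [oU Uz nuU]] : exists U, [/\ @open R[i]^o U, U z & ~ (0 < nu U)%E].
    apply: contrapT => h; apply: zs => U oU Uz; apply: contrapT => h'.
    by apply: h; exists U.
  have [k [kz kU]] := rball_refine oU Uz.
  exists (pickle k); first exact: I.
  rewrite /F pickleK ifT; first exact: kz.
  rewrite eq_le measure_ge0 andbT leNgt; apply/negP => kgt; apply: nuU.
  apply: lt_le_trans kgt _; apply: le_measure => //; rewrite inE; apply: sub_sigma_algebra => //.
  exact: ball_open.
apply: negligible_bigcup => n; rewrite /F; case: unpickle => [k|]; last exact: negligible_set0.
case: eqP => [k0|_]; last exact: negligible_set0.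
exists (rball k); split => //; apply: sub_sigma_algebra; exact: ball_open.
Qed.

Lemma compactly_supported_ae_le : compactly_supported nu ->
  exists2 r : R, 0 <= r & {ae nu, forall z : borelC R, `|z : R[i]| <= r%:C}.
Proof.
move=> cs.
have /compact_bounded[M [_ Mb]] := continuous_compact
  (continuous_subspaceT (@continuous_Re_norm R)) cs.
(* Boundedness provides the estimate only for reals strictly above [M], a number of unknown sign. *)
exists (`|M| + 1); first by rewrite addr_ge0.
apply: negligibleS support_negligible => z /= zr zs; apply: zr.
rewrite -Re_norm lecR; apply: le_trans (ler_norm _) _.
by apply: Mb; [rewrite ltr_pwDr// ler_norm|exists z].
Qed.

End SupportNull.

(** * Moments of the circle *)

Section CircleMoments.
Context (R : realType).

Let U : probability _ R := uniform_prob (@two_pi_gt0 R).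

(** Fundamental theorem of calculus over a full turn: the primitive [F] takes the same value at both
    ends. *)
Lemma integral_uniform_derivative (f F : R -> R) : continuous f ->
  (forall t, `|f t| <= 1) -> (forall t, is_derive t (1 : R) F (f t)) ->
  F (pi *+ 2) = F 0 -> U.-integrable setT (EFin \o f) /\ Rintegral U setT f = 0.
Proof.
move=> cf f1 dF F2pi.
have mf : measurable_fun setT f by exact: continuous_measurable_fun.
have fi : U.-integrable setT (EFin \o f).
  apply: measurable_bounded_integrable => //.
    by rewrite [X in (X < _)%E]probability_setT ltry.
  by exists 1; split => // M M1 t _ /=; exact: le_trans (f1 t) (ltW M1).
split => //.
have ci : U.-integrable setT (EFin \o cst (1 : R)).
  by apply: finite_measure_integrable_cst.
have fge t : -1 <= f t by have := f1 t; rewrite ler_norml => /andP[].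
(* [integral_uniform] only applies to nonnegative integrands, hence [1 + f]. *)
suff E : Rintegral U setT (fun t => 1 + f t) = 1.
  have := E; rewrite RintegralD// Rintegral_cst// mul1r. rewrite [X in fine X]probability_setT /=.
  by move=> /(congr1 (fun x => x - 1)); rewrite addrAC subrr add0r.
rewrite /Rintegral integral_uniform; last 2 first.
- by apply/measurable_EFinP; apply: measurable_funD => //; exact: measurable_cst.
- by move=> t; rewrite lee_fin; have := fge t; lra.
(* A primitive of [1 + f]; it grows by exactly [2 pi], so the mean of [1 + f] is 1. *)
pose G t := t + F t.
have dG t : is_derive t (1 : R) G (1 + f t) by apply: is_deriveD.
rewrite (@continuous_FTC2 _ (fun t => 1 + f t) G).
- rewrite /G F2pi -EFinB -EFinM /= subr0 add0r -addrA subrr addr0 mulVf//.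
  by rewrite gt_eqF ?two_pi_gt0.
- exact: two_pi_gt0.
- by apply: continuous_subspaceT => t; apply: cvgD; [exact: cvg_cst|exact: cf].
- have cG t : {for t, continuous G}.
    by apply: differentiable_continuous; apply/derivable1_diffP; apply: ex_derive.
  split => //.
  + exact/cvg_at_right_filter/cG.
  + exact/cvg_at_left_filter/cG.
- by move=> t _; rewrite derive1E derive_val.
Qed.

Lemma expc_circle_param n (t : R) :
  (circle_param t : R[i]) ^+ n = cos (n%:R * t) +i* sin (n%:R * t).
Proof.
elim: n => [|n IH]; first by rewrite expr0 mul0r cos0 sin0.
rewrite exprS IH /circle_param -[n.+1]addn1 natrD mulrDl mul1r.
by apply/eqP; rewrite eq_complex /= cosD sinD; apply/andP; split; apply/eqP; ring.
Qed.

Lemma monomial_circle_param n m (t : R) : monomial n m (circle_param t) =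
  cos ((n%:R - m%:R) * t) +i* sin ((n%:R - m%:R) * t).
Proof.
rewrite /monomial -rmorphXn !expc_circle_param mulrBl.
by apply/eqP; rewrite eq_complex /= cosB sinB; apply/andP; split; apply/eqP; ring.
Qed.

Lemma cos_nat_2pi n : cos (n%:R * pi *+ 2 : R) = 1.
Proof.
rewrite -mulrnAr mulr_natl -[X in cos X]add0r (periodicn (@cosD2pi R)); exact: cos0.
Qed.

Lemma sin_nat_2pi n : sin (n%:R * pi *+ 2 : R) = 0.
Proof.
rewrite -mulrnAr mulr_natl -[X in sin X]add0r (periodicn (@sinD2pi R)); exact: sin0.
Qed.

Lemma integral_uniform_monomial n m :
  [/\ U.-integrable setT (EFin \o (fun t => complex.Re (monomial n m (circle_param t)))),
      U.-integrable setT (EFin \o (fun t => complex.Im (monomial n m (circle_param t)))),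
      Rintegral U setT (fun t => complex.Re (monomial n m (circle_param t))) = (n == m)%:R &
      Rintegral U setT (fun t => complex.Im (monomial n m (circle_param t))) = 0].
Proof.
have [->|nm] := eqVneq n m.
  have E t : monomial m m (circle_param t) = 1 :> R[i].
    by rewrite monomial_circle_param subrr mul0r cos0 sin0.
  under [X in EFin \o X]eq_fun do rewrite E.
  under [X in Rintegral _ _ X]eq_fun do rewrite E.
  have ci (c : R) : U.-integrable setT (EFin \o cst c).
    exact: finite_measure_integrable_cst.
  split => //=; first exact: (ci 1).
  - under [X in EFin \o X]eq_fun do rewrite E.
    exact: (ci 0).
  - by rewrite Rintegral_cst// mul1r [X in fine X]probability_setT.
  - under eq_Rintegral do rewrite E.
    by rewrite Rintegral_cst// mul0r.
set k : R := n%:R - m%:R.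
have k0 : k != 0 by rewrite subr_eq0 eqr_nat.
have dZ (c a : R) (h : R -> R) (t : R) : is_derive t (1 : R) h a ->
    is_derive t (1 : R) (fun x => c * h x) (c * a).
  by move=> dh; exact: is_deriveZ.
have dcomp (h : R -> R) (t a : R) : is_derive (k * t) (1 : R) h a ->
    is_derive t (1 : R) (fun x => h (k * x)) (a * k).
  move=> dh; apply: is_derive1_comp.
  by rewrite -[X in is_derive _ _ _ X]mulr1; exact: (dZ k 1 id).
(* As [k] may be negative, [k * 2 pi] is written as a difference of natural multiples of [2 pi],
   where the addition formulas and periodicity apply. *)
have Fpi : k * (pi *+ 2) = n%:R * pi *+ 2 - m%:R * pi *+ 2 by rewrite /k; ring.
have ck : continuous (fun t : R => k * t).
  exact: mulrl_continuous.
have [c1 c2] : U.-integrable setT (EFin \o (fun t => cos (k * t))) /\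
    Rintegral U setT (fun t => cos (k * t)) = 0.
  apply: (@integral_uniform_derivative _ (fun t => k^-1 * sin (k * t))).
  - by move=> t; apply: continuous_comp; [exact: ck|exact: continuous_cos].
  - by move=> t; rewrite ler_norml cos_geN1 cos_le1.
  - move=> t; apply: (is_derive_eq (dZ _ _ _ _ (dcomp _ _ _ (is_derive_sin (k * t))))).
    by rewrite mulrCA mulVf// mulr1.
  - by rewrite Fpi sinB !sin_nat_2pi (mulr0 k) sin0; ring.
have [s1 s2] : U.-integrable setT (EFin \o (fun t => sin (k * t))) /\
    Rintegral U setT (fun t => sin (k * t)) = 0.
  apply: (@integral_uniform_derivative _ (fun t => (- k^-1) * cos (k * t))).
  - by move=> t; apply: continuous_comp; [exact: ck|exact: continuous_sin].
  - by move=> t; rewrite ler_norml sin_geN1 sin_le1.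
  - move=> t; apply: (is_derive_eq (dZ _ _ _ _ (dcomp _ _ _ (is_derive_cos (k * t))))).
    by rewrite !mulNr mulrN opprK mulrCA mulVf// mulr1.
  - by rewrite Fpi cosB !sin_nat_2pi !cos_nat_2pi (mulr0 k) cos0; ring.
have -> : (fun t : R => complex.Re (monomial n m (circle_param t))) = fun t => cos (k * t).
  by apply/funext => t; rewrite monomial_circle_param.
have -> : (fun t : R => complex.Im (monomial n m (circle_param t))) = fun t => sin (k * t).
  by apply/funext => t; rewrite monomial_circle_param.
by split.
Qed.

Lemma measurable_Re_monomial n m :
  measurable_fun setT (fun z : borelC R => complex.Re (monomial n m z)).
Proof.
apply: continuous_measurable_borelC => z.
exact: (continuous_comp (@continuous_monomial _ n m z) (@continuous_Re _ _)).
Qed.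

Lemma measurable_Im_monomial n m :
  measurable_fun setT (fun z : borelC R => complex.Im (monomial n m z)).
Proof.
apply: continuous_measurable_borelC => z.
exact: (continuous_comp (@continuous_monomial _ n m z) (@continuous_Im _ _)).
Qed.

Lemma circle_finite_moments : finite_moments (circle_measure R).
Proof.
move=> n m; have [ri ii _ _] := integral_uniform_monomial n m.
split; apply: integrable_pushforward => //; apply/measurable_EFinP.
- exact: measurable_Re_monomial.
- exact: measurable_Im_monomial.
Qed.

Lemma circle_moment n m : moment (circle_measure R) n m = (n == m)%:R.
Proof.
have [ri ii rE iE] := integral_uniform_monomial n m.
have mR := measurable_Re_monomial n m; have mI := measurable_Im_monomial n m.
move/measurable_EFinP in mR; move/measurable_EFinP in mI.
transitivity (Rintegral U setT (fun t => complex.Re (monomial n m (circle_param t))) +i*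
              Rintegral U setT (fun t => complex.Im (monomial n m (circle_param t)))).
  by congr (fine _ +i* fine _); exact: integral_distribution.
by rewrite rE iE; case: (n == m).
Qed.

End CircleMoments.

(** * Multiplication by the variable in the Sobolev norm *)

(** Parseval: the moment matrix of the circle is the identity, so only the diagonal of the double
    sum survives. *)
Lemma normsq_int_circle (R : realType) (p : {poly R[i]}) :
  normsq_int (circle_measure R) p = normsq_coef p.
Proof.
rewrite (normsq_int_moments (@circle_finite_moments R) (leqnn _)).
apply: eq_bigr => i _; rewrite (bigD1 i)//= circle_moment eqxx mulr1 -sqr_normc.
rewrite big1 ?addr0// => j ji; rewrite circle_moment (_ : (i == j :> nat) = false) ?mulr0//.
by rewrite eq_sym; apply/negbTE.
Qed.

Section SobolevShift.
Context (R : realType) (mu : {measure set (borelC R) -> \bar R}) (r : R).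
Hypotheses (mom : finite_moments mu) (r0 : 0 <= r)
  (mur : {ae mu, forall z : borelC R, `|z : R[i]| <= r%:C}).
Implicit Types p : {poly R[i]}.

(** The 1 comes from the shift preserving [normsq_coef]. In the derivative [p + 'X * p'], each
    factor 2 comes from the parallelogram bound, [|b|] from comparing [p] with its coefficients, and
    [r ^+ 2] from the disc. *)
Lemma shift_le_of_upper (b : R) p :
  (forall q, normsq_int mu q <= b%:C * normsq_coef q) ->
  normsq_coef ('X * p) + normsq_int mu ('X * p)^`() <=
  (1 + 2 * `|b| + 2 * r ^+ 2)%:C * (normsq_coef p + normsq_int mu p^`()).
Proof.
move=> mub; rewrite normsq_coefMX derivM derivX mul1r.
have h1 := normsq_intD_le p ('X * p^`()) mom.
have h2 := normsq_intMX_le p^`() mom r0 mur.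
have h3 := mub p.
have b0 : 0 <= `|b|%:C :> R[i] by rewrite ler0c.
have bb : b%:C <= `|b|%:C :> R[i] by rewrite lecR ler_norm.
have c0 := normsq_coef_ge0 p; have i0 := normsq_int_ge0 mu p^`().
have rr0 : 0 <= (r ^+ 2)%:C :> R[i] by rewrite ler0c sqr_ge0.
have h4 := le_trans h3 (ler_wpM2r c0 bb).
move: (r ^+ 2) h2 rr0 => r2 h2 rr0; rewrite !rmorphD !rmorphM rmorph1 /= !rmorph_nat.
move: h1 h2 h4 c0 i0 rr0 b0 (mulr_ge0 b0 i0) (mulr_ge0 rr0 c0).
move: (normsq_int mu (p + _)) (normsq_int mu p) (normsq_int mu ('X * _)) => A B D.
move: (normsq_coef p) (normsq_int mu p^`()) r2%:C `|b|%:C => E F G H.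
move=> h1 h2 h4 *.
(* The intermediate bound keeps the useful products of the expanded right-hand side; the others are
   nonnegative. *)
apply: (@le_trans _ _ (E + (2 * (H * E) + 2 * (G * F)))).
  by rewrite lerD2l; apply: le_trans h1 _; rewrite lerD// ler_pM2l.
rewrite -subr_ge0 (_ : _ - _ = F + (2 * (H * F) + 2 * (G * E))); last by ring.
by rewrite !addr_ge0// mulr_ge0.
Qed.

(** Here [r ^+ 2] bounds the shift of [p] in the norm of [mu]. For the derivative, [l^-1] controls
    the coefficients of [p] by its norm in [mu], and the last 2 belongs to ['X * p'], whose
    coefficient norm is that of [p']. *)
Lemma shift_le_of_lower (l : R) p : 0 < l ->
  (forall q, l%:C * normsq_coef q <= normsq_int mu q) ->
  normsq_int mu ('X * p) + normsq_coef ('X * p)^`() <=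
  (r ^+ 2 + 2 * l^-1 + 2)%:C * (normsq_int mu p + normsq_coef p^`()).
Proof.
move=> l0 mul; rewrite derivM derivX mul1r.
have h1 := normsq_coefD_le p ('X * p^`()).
have h2 := normsq_intMX_le p mom r0 mur.
have h3 : normsq_coef p <= l^-1%:C * normsq_int mu p.
  rewrite -(@ler_pM2l _ l%:C) ?ltcR// mulrA -rmorphM mulfV ?gt_eqF// mul1r.
  exact: mul.
have c0 := normsq_coef_ge0 p^`(); have i0 := normsq_int_ge0 mu p.
have rr0 : 0 <= (r ^+ 2)%:C :> R[i] by rewrite ler0c sqr_ge0.
have ll0 : 0 <= l^-1%:C :> R[i] by rewrite ler0c invr_ge0 ltW.
rewrite normsq_coefMX in h1.
move: (r ^+ 2) h2 rr0 => r2 h2 rr0; rewrite !rmorphD rmorphM /= !rmorph_nat.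
move: h1 h2 h3 c0 i0 rr0 ll0 (mulr_ge0 rr0 c0) (mulr_ge0 ll0 c0).
move: (normsq_coef (p + _)) (normsq_coef p) (normsq_int mu ('X * _)) => A B D.
move: (normsq_coef p^`()) (normsq_int mu p) r2%:C l^-1%:C => E F G H.
move=> h1 h2 h3 *.
apply: (@le_trans _ _ (G * F + (2 * (H * F) + 2 * E))).
  by rewrite lerD//; apply: le_trans h1 _; rewrite lerD2r ler_pM2l.
rewrite -subr_ge0 (_ : _ - _ = G * E + (2 * (H * E) + 2 * F)); last by ring.
by rewrite !addr_ge0// mulr_ge0.
Qed.

End SobolevShift.

(** * Boundedness of the zeros *)

Lemma bounded_orthonormal_zeros (R : realType) (S : {dot {poly R[i]} for Num.conj}) (c : R) :
  (forall q, S ('X * q) ('X * q) <= c%:C * S q q) ->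
  bounded_set (orthonormal_zeros S).
Proof.
(* From [|z|^2 <= c] follows [|z| <= 1 + |c|], a bound that avoids square roots. *)
move=> Sc; exists (1 + `|c|)%:C; split; first by apply/complex_realP; eexists.
move=> M Mc z [n /(orthonormal_zeros_sqr_le Sc) zc] /=.
apply: le_trans (ltW Mc).
rewrite -(Re_norm z) lecR; move: zc; rewrite -(Re_norm z) -rmorphXn lecR.
move: (complex.Re _) => x /= xc; have := ler_norm c; nra.
Qed.

Theorem corollary8 (R : realType) (mu : {measure set (borelC R) -> \bar R})
    (lambda beta : nat -> R)
    (mu_infinite : infinitely_supported mu)
    (mu_compact : compactly_supported mu)
    (mu_moments : finite_moments mu)
    (lambdaP : forall n : nat,
       smallest_eigenvalue (moment_section mu n) (lambda n))
    (betaP : forall n : nat,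
       largest_eigenvalue (moment_section mu n) (beta n)) :
  ((limn (fun n => (beta n)%:E) < +oo)%E ->
   forall S : {dot {poly R[i]} for Num.conj},
     is_sobolev_product (circle_measure R) mu S ->
     bounded_set (orthonormal_zeros S)) /\
  ((0 < limn (fun n => (lambda n)%:E))%E ->
   forall S : {dot {poly R[i]} for Num.conj},
     is_sobolev_product mu (circle_measure R) S ->
     bounded_set (orthonormal_zeros S)).
Proof.
have [r r0 mur] := compactly_supported_ae_le mu_compact.
split=> [/(normsq_int_le_limn mu_moments betaP)[b mub]|
         /(normsq_int_ge_limn mu_moments lambdaP)[l l0 mul]] S SP.
- apply: (@bounded_orthonormal_zeros _ _ (1 + 2 * `|b| + 2 * r ^+ 2)) => q.
  (* On both sides the circle integral becomes [normsq_coef], which turns the goal into the shift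
     estimate. *)
  rewrite !SP -!/(normsq_int _ _) !normsq_int_circle.
  exact: shift_le_of_upper.
- apply: (@bounded_orthonormal_zeros _ _ (r ^+ 2 + 2 * l^-1 + 2)) => q.
  rewrite !SP -!/(normsq_int _ _) !normsq_int_circle.
  exact: shift_le_of_lower.
Qed.
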